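(* Let $\mathcal{E}$ be a Heyting category equipped with a mono-coreflective subcategory with (monic) counit $\ell$. The maps of $\mathcal{E}$ that are on top of $\ell$ form an ideal of $\mathcal{E}$. If, moreover, $\ell$ is mono-cartesian, then this ideal is idempotent; in fact, for any $f$ on top of $\ell$, both maps in the epi/mono (i.e. regular-epi/mono) factorization of $f$ are on top of $\ell$.
   Context: In a Heyting category, $\Rightarrow$ denotes the implication in the Heyting algebra of subobjects of an object. A subcategory is mono-coreflective if it is coreflective and the counit of the coreflection is monic (equivalently, one has an idempotent comonad with monic counit). Write $\ell_X$ for the component of the counit at $X$, regarded as a subobject of $X$. For a map $f:Y\to X$ and subobjects $u,v$ of $X$, write $\partial_f u\leq v$ if $f$ factors through the subobject $u\vee(u\Rightarrow v)$ of $X$. A map $f:Y\to X$ is on top of a subobject $v$ of $X$ if $\partial_f u\leq v$ for every subobject $u$ of $X$. A map $f$ is on top of $\ell$ if it is on top of $\ell_X$, where $X$ is the codomain of $f$. A natural transformation is mono-cartesian if its naturality square at every monomorphism is a pullback. An ideal of a category (not necessarily small) is a collection $\mathcal{I}$ of maps such that whenever $f\in\mathcal{I}$, also $fg\in\mathcal{I}$ and $hf\in\mathcal{I}$ whenever the composites are defined; it is idempotent if every $f\in\mathcal{I}$ is of the form $f=gh$ with $g,h\in\mathcal{I}$. *)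

(* Defs.v *)
From Stdlib Require Import ssreflect ProofIrrelevance.

Set Implicit Arguments.
Unset Strict Implicit.
Unset Printing Implicit Defensive.

(** * Categories, functors, adjunctions *)

Record category := Category {
  ob :> Type;
  hom : ob -> ob -> Type;
  idm : forall X, hom X X;
  comp : forall X Y Z, hom Y Z -> hom X Y -> hom X Z;
  comp_idl : forall X Y (f : hom X Y), comp (idm Y) f = f;
  comp_idr : forall X Y (f : hom X Y), comp f (idm X) = f;
  compA : forall W X Y Z (h : hom Y Z) (g : hom X Y) (f : hom W X),
    comp h (comp g f) = comp (comp h g) f }.

Arguments hom {c} _ _.
Arguments idm {c} X.
Arguments comp {c X Y Z} _ _.

Declare Scope cat_scope.
Delimit Scope cat_scope with cat.
Notation "g \o f" := (comp g f) (at level 40, left associativity) : cat_scope.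
Local Open Scope cat_scope.

Record functor (C D : category) := Functor {
  fob :> C -> D;
  fhom : forall X Y : C, hom X Y -> hom (fob X) (fob Y);
  fhom_id : forall X : C, fhom (idm X) = idm (fob X);
  fhom_comp : forall (X Y Z : C) (g : hom Y Z) (f : hom X Y),
    fhom (g \o f) = fhom g \o fhom f }.

Arguments fhom {C D} _ {X Y} _.

Definition functor_id (C : category) : functor C C :=
  @Functor C C (fun X => X) (fun _ _ f => f)
    (fun _ => eq_refl) (fun _ _ _ _ _ => eq_refl).

Definition functor_comp (B C D : category) (G : functor C D) (F : functor B C) :
  functor B D.
Proof.
apply: (@Functor B D (fun X => G (F X)) (fun _ _ f => fhom G (fhom F f))).
- by move=> X; rewrite !fhom_id.
- by move=> X Y Z g f; rewrite !fhom_comp.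
Defined.

Record nattrans (C D : category) (F G : functor C D) := NatTrans {
  component :> forall X : C, hom (F X) (G X);
  naturality : forall (X Y : C) (f : hom X Y),
    fhom G f \o component X = component Y \o fhom F f }.

Record adjunction (C D : category) (F : functor C D) (G : functor D C) :=
  Adjunction {
  unit : nattrans (functor_id C) (functor_comp G F);
  counit : nattrans (functor_comp F G) (functor_id D);
  triangle_l : forall X : C, counit (F X) \o fhom F (unit X) = idm (F X);
  triangle_r : forall Y : D, fhom G (counit Y) \o unit (G Y) = idm (G Y) }.

(** * Special morphisms *)

Section Morphisms.
Variable C : category.
Implicit Types X Y Z : C.

Definition mono X Y (f : hom X Y) :=
  forall Z (g h : hom Z X), f \o g = f \o h -> g = h.

Definition is_pullback P X Y Z (p : hom P X) (q : hom P Y)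
    (f : hom X Z) (g : hom Y Z) :=
  f \o p = g \o q /\
  forall W (a : hom W X) (b : hom W Y), f \o a = g \o b ->
    exists! t : hom W P, p \o t = a /\ q \o t = b.

Definition is_coequalizer X Y Q (p q : hom X Y) (e : hom Y Q) :=
  e \o p = e \o q /\
  forall W (a : hom Y W), a \o p = a \o q -> exists! t : hom Q W, t \o e = a.

Definition regular_epi Y Q (e : hom Y Q) :=
  exists X (p q : hom X Y), is_coequalizer p q e.

(** Subobjects of [X] are represented by monomorphisms into [X]; two of them
    represent the same subobject when they are related by [sub_eq]. *)
Record sub X := Sub {
  sub_dom : C;
  incl : hom sub_dom X;
  incl_mono : mono incl }.

Definition factors_through Y X (f : hom Y X) (u : sub X) :=
  exists g : hom Y (sub_dom u), incl u \o g = f.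

Definition sub_le X (u v : sub X) := factors_through (incl u) v.

Definition sub_eq X (u v : sub X) := sub_le u v /\ sub_le v u.

Lemma comp_mono X Y Z (g : hom Y Z) (f : hom X Y) :
  mono g -> mono f -> mono (g \o f).
Proof. by move=> mg mf W a b; rewrite -!compA => /mg /mf. Qed.

Lemma pullback_mono P X Y Z (p : hom P X) (q : hom P Y)
    (f : hom X Z) (g : hom Y Z) :
  is_pullback p q f g -> mono g -> mono p.
Proof.
move=> [sq univ] mg W a b pab.
have qab : q \o a = q \o b by apply: mg; rewrite !compA -sq -!compA pab.
have [|t [_ uniq]] := univ W (p \o b) (q \o b); first by rewrite !compA sq.
by rewrite -(uniq a) // -(uniq b).
Qed.

End Morphisms.

Arguments incl {C X} s.
Arguments sub_dom {C X} s.

Definition mono_cartesian (C D : category) (F G : functor C D)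
    (a : nattrans F G) :=
  forall (X Y : C) (m : hom X Y), mono m ->
    is_pullback (a X) (fhom F m) (fhom G m) (a Y).

(** * Heyting categories *)

(** All limits and lattice operations below come as chosen structure; each is
    determined up to isomorphism by its universal property.  A terminal object
    and pullbacks give all finite limits. *)
Record regular_category := RegularCategory {
  regular_cat :> category;
  terminal : regular_cat;
  terminalP : forall X : regular_cat, exists! f : hom X terminal, True;
  pb : forall X Y Z : regular_cat, hom X Z -> hom Y Z -> regular_cat;
  pb_fst : forall (X Y Z : regular_cat) (f : hom X Z) (g : hom Y Z),
    hom (pb f g) X;
  pb_snd : forall (X Y Z : regular_cat) (f : hom X Z) (g : hom Y Z),
    hom (pb f g) Y;
  pbP : forall (X Y Z : regular_cat) (f : hom X Z) (g : hom Y Z),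
    is_pullback (pb_fst f g) (pb_snd f g) f g;
  kernel_pair_coeq : forall (X Y : regular_cat) (f : hom X Y),
    exists (Q : regular_cat) (e : hom X Q),
      is_coequalizer (pb_fst f f) (pb_snd f f) e;
  regular_epi_stable : forall (P X Y Z : regular_cat)
      (p : hom P X) (q : hom P Y) (f : hom X Z) (g : hom Y Z),
    is_pullback p q f g -> regular_epi g -> regular_epi p }.

Definition sub_pull (C : regular_category) (X Y : C) (f : hom Y X) (u : sub X) :
    sub Y :=
  Sub (pullback_mono (pbP f (incl u)) (@incl_mono _ _ u)).

Definition sub_meet (C : regular_category) (X : C) (u v : sub X) : sub X :=
  Sub (comp_mono (@incl_mono _ _ u)
                 (@incl_mono _ _ (sub_pull (incl u) v))).

Record coherent_category := CoherentCategory {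
  coherent_regular :> regular_category;
  sub_bot : forall X : coherent_regular, sub X;
  sub_botP : forall (X : coherent_regular) (u : sub X), sub_le (sub_bot X) u;
  sub_bot_stable : forall (X Y : coherent_regular) (f : hom Y X),
    sub_eq (sub_pull f (sub_bot X)) (sub_bot Y);
  sub_join : forall X : coherent_regular, sub X -> sub X -> sub X;
  sub_joinP : forall (X : coherent_regular) (u v w : sub X),
    sub_le (sub_join u v) w <-> sub_le u w /\ sub_le v w;
  sub_join_stable : forall (X Y : coherent_regular) (f : hom Y X) (u v : sub X),
    sub_eq (sub_pull f (sub_join u v))
           (sub_join (sub_pull f u) (sub_pull f v)) }.

Record heyting_category := HeytingCategory {
  heyting_coherent :> coherent_category;
  sub_forall : forall X Y : heyting_coherent, hom Y X -> sub Y -> sub X;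
  sub_forallP : forall (X Y : heyting_coherent) (f : hom Y X)
      (t : sub X) (w : sub Y),
    sub_le t (sub_forall f w) <-> sub_le (sub_pull f t) w }.

(** The implication of the Heyting algebra of subobjects; [sub_impP] is its
    universal property. *)
Definition sub_imp (E : heyting_category) (X : E) (u v : sub X) : sub X :=
  sub_forall (incl u) (sub_pull (incl u) v).

Lemma sub_meet_le (C : regular_category) (X : C) (t u v : sub X) :
  sub_le (sub_meet u t) v <-> sub_le (sub_pull (incl u) t) (sub_pull (incl u) v).
Proof.
have [sq univ] := pbP (incl u) (incl v); split=> -[g /= gE].
- have [|t' [[tE _] _]] := univ _ (pb_fst (incl u) (incl t)) g; first by rewrite gE.
  by exists t'.
- by exists (pb_snd (incl u) (incl v) \o g); rewrite compA -sq -compA gE.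
Qed.

Lemma sub_impP (E : heyting_category) (X : E) (t u v : sub X) :
  sub_le t (sub_imp u v) <-> sub_le (sub_meet u t) v.
Proof.
have Hf := sub_forallP (incl u) t (sub_pull (incl u) v).
by have Hm := sub_meet_le t u v; split=> [/Hf /Hm | /Hm /Hf].
Qed.

(** * Mono-coreflective subcategories *)

(** Subcategories are not assumed full; the case where [sub_hom] always holds
    is that of full subcategories. *)
Record subcategory (C : category) := Subcategory {
  sub_ob : C -> Prop;
  sub_hom : forall X Y : C, hom X Y -> Prop;
  sub_hom_id : forall X : C, sub_ob X -> sub_hom (idm X);
  sub_hom_comp : forall (X Y Z : C) (g : hom Y Z) (f : hom X Y),
    sub_ob X -> sub_ob Y -> sub_ob Z ->
    sub_hom g -> sub_hom f -> sub_hom (g \o f) }.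

Lemma sub_hom_eq (C : category) (S : subcategory C) (X Y : C)
    (f g : {f : hom X Y | sub_hom S f}) :
  proj1_sig f = proj1_sig g -> f = g.
Proof.
case: f g => [f pf] [g pg] /= fg; case: g / fg pg => pg.
by rewrite (proof_irrelevance _ pf pg).
Qed.

Definition subcat (C : category) (S : subcategory C) : category.
Proof.
apply: (@Category {X : C | sub_ob S X}
  (fun X Y => {f : hom (proj1_sig X) (proj1_sig Y) | sub_hom S f})
  (fun X => exist _ (idm (proj1_sig X)) (sub_hom_id (proj2_sig X)))
  (fun X Y Z g f => exist _ (proj1_sig g \o proj1_sig f)
    (sub_hom_comp (proj2_sig X) (proj2_sig Y) (proj2_sig Z)
                  (proj2_sig g) (proj2_sig f)))).
- by move=> X Y f; apply: sub_hom_eq; apply: comp_idl.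
- by move=> X Y f; apply: sub_hom_eq; apply: comp_idr.
- by move=> W X Y Z h g f; apply: sub_hom_eq; apply: compA.
Defined.

Definition inclusion (C : category) (S : subcategory C) : functor (subcat S) C :=
  @Functor (subcat S) C (fun X => proj1_sig X) (fun _ _ f => proj1_sig f)
    (fun _ => eq_refl) (fun _ _ _ _ _ => eq_refl).

Record mono_coreflection (C : category) (S : subcategory C) := MonoCoreflection {
  coreflector : functor C (subcat S);
  coreflection_adj : adjunction (inclusion S) coreflector;
  coreflection_mono : forall X : C, mono (counit coreflection_adj X) }.

Definition ell (C : category) (S : subcategory C) (L : mono_coreflection S) :
    nattrans (functor_comp (inclusion S) (coreflector L)) (functor_id C) :=
  counit (coreflection_adj L).

Definition ell_sub (C : category) (S : subcategory C) (L : mono_coreflection S)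
    (X : C) : sub X :=
  Sub (@coreflection_mono C S L X).

(** * Boundaries *)

Definition boundary_le (E : heyting_category) (X Y : E) (f : hom Y X)
    (u v : sub X) :=
  factors_through f (sub_join u (sub_imp u v)).

Definition on_top_of (E : heyting_category) (X Y : E) (f : hom Y X) (v : sub X) :=
  forall u : sub X, boundary_le f u v.

Definition on_top_of_ell (E : heyting_category) (S : subcategory E)
    (L : mono_coreflection S) (Y X : E) (f : hom Y X) :=
  on_top_of f (ell_sub L X).

(** * Ideals *)

Definition is_ideal (C : category) (I : forall Y X : C, hom Y X -> Prop) :=
  (forall (X Y Z : C) (f : hom Y X) (g : hom Z Y), I Y X f -> I Z X (f \o g)) /\
  (forall (X Y Z : C) (f : hom Y X) (h : hom X Z), I Y X f -> I Y Z (h \o f)).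

Definition idempotent (C : category) (I : forall Y X : C, hom Y X -> Prop) :=
  forall (X Y : C) (f : hom Y X), I Y X f ->
    exists (Z : C) (g : hom Z X) (h : hom Y Z), I Z X g /\ I Y Z h /\ f = g \o h.

(* Main.v *)
From Stdlib Require Import ssreflect.
Require Import Defs.

Set Implicit Arguments.
Unset Strict Implicit.
Unset Printing Implicit Defensive.

Local Open Scope cat_scope.

(** The whole statement rests on the stability of boundaries under pullback:
    for [h : X -> Z], a map [h f] satisfies [boundary_le _ u v] exactly when [f]
    satisfies it for the pulled back subobjects [h^*u] and [h^*v]
    ([boundary_le_comp]).  Joins are stable by assumption.  Stability of
    implication is derived from the Kripke-Joyal description of [u => v]
    ([factors_through_imp]): a map [f] factors through [u => v] as soon as
    every [f a] that factors through [u] factors through [v].  This is where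
    regularity enters: the universal property of [u => v] speaks only of
    monomorphisms, so [f] is replaced by its image, and what is known about
    [f] descends along the regular epimorphism onto the image.

    The ideal property follows: precomposition is immediate, and for
    postcomposition with [h : X -> Z], naturality gives [ell_X <= h^* ell_Z],
    so being on top of [ell_X] at [h^*u] gives being on top of [ell_Z] at [u].

    For a factorization [f = m e] with [m] monic and [e] a regular epimorphism,
    whatever subobject [f] factors through, [m] also factors through; hence [m] is
    on top of [ell].  For [e], every subobject [w] of the image is [m^*] of
    [m w], so the boundary condition on [f] at [m w] says that [e] satisfies
    it at [w] relative to [m^* ell], and [m^* ell <= ell] when [ell] is
    mono-cartesian. *)

(** * Regular epimorphisms and images *)

Lemma regular_epi_epi (C : category) (Y Q W : C) (e : hom Y Q) (a b : hom Q W) :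
  regular_epi e -> a \o e = b \o e -> a = b.
Proof.
move=> [X [p [q [epq univ]]]] ab.
have [|t [_ uniq]] := univ W (b \o e); first by rewrite -!compA epq.
by rewrite -(uniq a) // -(uniq b).
Qed.

(** Regular epimorphisms are strong: a factorization through a subobject, being
    unique, coequalizes the pair that the epimorphism coequalizes. *)
Lemma factors_through_epi (C : category) (Y Q X : C) (e : hom Y Q) (x : hom Q X)
    (u : sub X) :
  regular_epi e -> factors_through (x \o e) u -> factors_through x u.
Proof.
move=> re [g gE]; have [T [p [q [epq univ]]]] := re.
have [|t [tE _]] := univ _ g.
  by apply: (@incl_mono _ _ u); rewrite !compA gE -!compA epq.
by exists t; apply: (regular_epi_epi re); rewrite -compA tE.
Qed.

(** The second factor [m] of [f] through the coequalizer [e] of its kernel pair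
    is monic: two maps [g], [h] identified by [m] lift, along a cover by
    regular epimorphisms, to two maps into [Y] identified by [f], which [e]
    identifies. *)
Lemma image_factorization (C : regular_category) (Y X : C) (f : hom Y X) :
  exists (Q : C) (e : hom Y Q) (m : hom Q X),
    regular_epi e /\ mono m /\ f = m \o e.
Proof.
have [Q [e coeq]] := kernel_pair_coeq f.
have re : regular_epi e by exists (pb f f), (pb_fst f f), (pb_snd f f).
have [kp kp_univ] := pbP f f.
have [ee e_univ] := coeq; have [m [mE _]] := e_univ X f kp.
exists Q, e, m; do 2!split=> //.
move=> T g h mgh.
have pb1 := pbP g e; have [sq1 _] := pb1.
have pb2 := pbP (h \o pb_fst g e) e; have [sq2 _] := pb2.
apply: (regular_epi_epi (regular_epi_stable pb1 re)).
apply: (regular_epi_epi (regular_epi_stable pb2 re)).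
rewrite sq2 sq1.
set a := pb_snd g e \o pb_fst (h \o pb_fst g e) e.
set b := pb_snd (h \o pb_fst g e) e.
have fab : f \o a = f \o b.
  by rewrite -mE -!compA -sq2 /a (compA e) -sq1 !compA mgh.
have [t [[ta tb] _]] := kp_univ _ a b fab.
by rewrite -compA -/a -ta -tb !compA ee.
Qed.

(** * Factorization through operations on subobjects *)

Lemma factors_through_comp (C : category) (X Y Z : C) (f : hom Y X) (g : hom Z Y)
    (u : sub X) :
  factors_through f u -> factors_through (f \o g) u.
Proof. by move=> [k <-]; exists (k \o g); rewrite compA. Qed.

Lemma factors_through_le (C : category) (X Y : C) (f : hom Y X) (u v : sub X) :
  factors_through f u -> sub_le u v -> factors_through f v.
Proof. by move=> [k <-] uv; apply: factors_through_comp. Qed.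

Lemma sub_le_refl (C : category) (X : C) (u : sub X) : sub_le u u.
Proof. by exists (idm _); rewrite comp_idr. Qed.

Lemma factors_through_pull (C : regular_category) (X Y Z : C) (h : hom X Z)
    (f : hom Y X) (u : sub Z) :
  factors_through f (sub_pull h u) <-> factors_through (h \o f) u.
Proof.
have [sq univ] := pbP h (incl u); split=> -[k kE].
- by exists (pb_snd h (incl u) \o k); rewrite compA -sq -compA -kE.
- have [t [[tE _] _]] := univ _ f k (eq_sym kE).
  by exists t.
Qed.

Lemma sub_pull_le (C : regular_category) (X Z : C) (h : hom X Z) (u v : sub Z) :
  sub_le u v -> sub_le (sub_pull h u) (sub_pull h v).
Proof.
move=> uv; apply/factors_through_pull; apply: factors_through_le uv.
exact/factors_through_pull/sub_le_refl.
Qed.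

Lemma sub_join_le (E : coherent_category) (X : E) (u u' v v' : sub X) :
  sub_le u u' -> sub_le v v' -> sub_le (sub_join u v) (sub_join u' v').
Proof.
have [/(_ (sub_le_refl _)) [l r] _] := sub_joinP u' v' (sub_join u' v').
move=> uu' vv'; apply/sub_joinP.
by split; [exact: factors_through_le uu' l | exact: factors_through_le vv' r].
Qed.

(** The Kripke-Joyal clause for implication.  For monic [f] it is [sub_impP];
    the general case follows because [f] and its image factor through the same
    subobjects.  It makes the stability of implication under pullback a formal
    consequence of [factors_through_pull]. *)
Lemma factors_through_imp (E : heyting_category) (X Y : E) (f : hom Y X)
    (u v : sub X) :
  factors_through f (sub_imp u v) <->
  forall (W : E) (a : hom W Y),
    factors_through (f \o a) u -> factors_through (f \o a) v.
Proof.
split=> [fuv W a fau | force].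
- have /sub_impP uv := sub_le_refl (sub_imp u v).
  apply: factors_through_le uv.
  have [k kE] := fau; rewrite -kE; have [j jE] : factors_through k
      (sub_pull (incl u) (sub_imp u v)).
    by apply/factors_through_pull; rewrite kE; apply: factors_through_comp.
  by exists j; rewrite -jE compA.
- have [Q [e [m [re [mm fE]]]]] := image_factorization f.
  suff: sub_le (Sub mm) (sub_imp u v).
    by rewrite fE; apply: factors_through_comp.
  (* Pulling back [e] covers the meet of [u] with the image of [f]; the
     composite of this cover with the inclusion of the meet factors through
     [f], so [force] applies to it. *)
  apply/sub_impP; rewrite /sub_le /=.
  have [sq _] := pbP (incl u) m.
  have pbe := pbP (pb_snd (incl u) m) e; have [sqe _] := pbe.
  apply: (factors_through_epi (regular_epi_stable pbe re)).
  have fq : f \o pb_snd (pb_snd (incl u) m) e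
      = incl u \o pb_fst (incl u) m \o pb_fst (pb_snd (incl u) m) e.
    by rewrite fE -compA -sqe compA sq.
  rewrite -fq; apply: force; rewrite fq -compA.
  by eexists.
Qed.

Lemma sub_imp_le (E : heyting_category) (X : E) (u u' v v' : sub X) :
  sub_le u' u -> sub_le v v' -> sub_le (sub_imp u v) (sub_imp u' v').
Proof.
move=> u'u vv'; apply/factors_through_imp => W a au'.
apply: factors_through_le vv'; move: (factors_through_le au' u'u).
by have /factors_through_imp := sub_le_refl (sub_imp u v); apply.
Qed.

Lemma sub_imp_stable (E : heyting_category) (X Z : E) (h : hom X Z)
    (u v : sub Z) :
  sub_eq (sub_pull h (sub_imp u v)) (sub_imp (sub_pull h u) (sub_pull h v)).
Proof.
split.
- apply/factors_through_imp => W a /factors_through_pull.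
  rewrite compA => hau; apply/factors_through_pull; rewrite compA.
  have /factors_through_pull /factors_through_imp :=
    sub_le_refl (sub_pull h (sub_imp u v)).
  exact.
- apply/factors_through_pull/factors_through_imp => W a.
  rewrite -compA => /factors_through_pull hau; apply/factors_through_pull.
  have /factors_through_imp := sub_le_refl (sub_imp (sub_pull h u) (sub_pull h v)).
  exact.
Qed.

(** * Boundaries *)

Lemma boundary_le_mono (E : heyting_category) (X Y : E) (f : hom Y X)
    (u u' v v' : sub X) :
  sub_eq u u' -> sub_le v v' -> boundary_le f u v -> boundary_le f u' v'.
Proof.
move=> [uu' u'u] vv' /factors_through_le; apply.
by apply: sub_join_le uu' _; apply: sub_imp_le.
Qed.

Lemma boundary_le_comp (E : heyting_category) (X Y Z : E) (f : hom Y X)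
    (h : hom X Z) (u v : sub Z) :
  boundary_le (h \o f) u v <-> boundary_le f (sub_pull h u) (sub_pull h v).
Proof.
have [join_l join_r] := sub_join_stable h u (sub_imp u v).
have [imp_l imp_r] := sub_imp_stable h u v.
split=> [/factors_through_pull | ] fb; last apply/factors_through_pull.
- apply: factors_through_le (factors_through_le fb join_l) _.
  exact: sub_join_le (sub_le_refl _) imp_l.
- apply: factors_through_le join_r; apply: factors_through_le fb _.
  exact: sub_join_le (sub_le_refl _) imp_r.
Qed.

(** Makes every subobject of the domain of a monomorphism a pullback along it,
    so that a boundary condition on the codomain reaches all of them. *)
Lemma sub_pull_image (C : regular_category) (X Z : C) (m : hom Z X)
    (mm : mono m) (w : sub Z) :
  sub_eq (sub_pull m (Sub (comp_mono mm (@incl_mono _ _ w)))) w.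
Proof.
split.
- have [sq _] := pbP m (m \o incl w).
  exists (pb_snd m (m \o incl w)); apply: (mm).
  by rewrite compA -sq.
- by apply/factors_through_pull; exists (idm _); rewrite comp_idr.
Qed.

Section OnTopOfEll.
Variables (E : heyting_category) (S : subcategory E) (L : mono_coreflection S).

Lemma ell_le_pull (X Z : E) (h : hom X Z) :
  sub_le (ell_sub L X) (sub_pull h (ell_sub L Z)).
Proof.
apply/factors_through_pull.
exists (fhom (functor_comp (inclusion S) (coreflector L)) h).
by rewrite -(naturality (ell L) h).
Qed.

Lemma pull_le_ell (X Z : E) (m : hom Z X) :
  mono_cartesian (ell L) -> mono m ->
  sub_le (sub_pull m (ell_sub L X)) (ell_sub L Z).
Proof.
move=> cart mm; have [_ univ] := cart _ _ _ mm.
have [sq _] := pbP m (incl (ell_sub L X)).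
by have [t [[tE _] _]] := univ _ _ _ sq; exists t.
Qed.

Lemma on_top_of_ell_ideal : is_ideal (on_top_of_ell L).
Proof.
split=> [X Y Z f g ft u | X Y Z f h ft u].
- exact/factors_through_comp/ft.
- apply/boundary_le_comp.
  apply: boundary_le_mono (ft (sub_pull h u)); last exact: ell_le_pull.
  by split; apply: sub_le_refl.
Qed.

Lemma on_top_of_ell_factors (X Y Z : E) (e : hom Y Z) (m : hom Z X) :
  mono_cartesian (ell L) -> regular_epi e -> mono m ->
  on_top_of_ell L (m \o e) -> on_top_of_ell L e /\ on_top_of_ell L m.
Proof.
move=> cart re mm ft; split=> u; last exact: factors_through_epi re (ft u).
have /boundary_le_comp := ft (Sub (comp_mono mm (@incl_mono _ _ u))).
by apply: boundary_le_mono; [apply: sub_pull_image | apply: pull_le_ell].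
Qed.

End OnTopOfEll.

Theorem proposition4p10 (E : heyting_category) (S : subcategory E)
    (L : mono_coreflection S) :
  is_ideal (on_top_of_ell L) /\
  (mono_cartesian (ell L) ->
     idempotent (on_top_of_ell L) /\
     forall (X Y : E) (f : hom Y X), on_top_of_ell L f ->
       forall (Z : E) (e : hom Y Z) (m : hom Z X),
         regular_epi e -> mono m -> f = m \o e ->
         on_top_of_ell L e /\ on_top_of_ell L m).
Proof.
split=> [|cart]; first exact: on_top_of_ell_ideal.
split=> [X Y f | X Y f + Z e m re mm fE].
- have [Q [e [m [re [mm ->]]]]] := image_factorization f.
  move=> /(on_top_of_ell_factors cart re mm) [te tm].
  by exists Q, m, e.
- by rewrite fE; apply: on_top_of_ell_factors.
Qed.
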